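(* Fix $a>0$. Then there exist, for all sufficiently large real $c>0$, complex numbers $z^*_c$ satisfying ${}_1F_1(a;c;z^*_c)=0$ and $\lim_{c\to\infty} z^*_c/c = 1$.
   Context: ${}_1F_1(a;c;z)=\sum_{k=0}^\infty \frac{(a)_k}{(c)_k}\frac{z^k}{k!}$ denotes Kummer's confluent hypergeometric function (an entire function of $z$ for $c>0$), where $(x)_k=\Gamma(x+k)/\Gamma(x)$ is the Pochhammer symbol. *)

(* Defs.v *)
From Stdlib Require Import Reals Factorial.
From Coquelicot Require Export Coquelicot.
Open Scope R_scope.

Fixpoint poch (x : R) (k : nat) : R :=
  match k with
  | O => 1
  | S k' => poch x k' * (x + INR k')
  end.

Definition F11_term (a c : R) (z : C) (k : nat) : C :=
  Cmult (RtoC (poch a k / (poch c k * INR (Factorial.fact k)))) (Cpow z k).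

Definition F11_value (a c : R) (z w : C) : Prop :=
  @is_series C_AbsRing C_NormedModule (F11_term a c z) w.

(* Main.v *)
(* After rescaling z = c w, the k-th coefficient of 1F1(a; c; c w) is positive, at most
   (a)_k / k! for every c, and at most c^k / k! once c >= a. So the function is bounded
   independently of c on compact subsets of |w| < 1, is at most e^(2c) for |w| <= 2, and is at
   least 1 on [0, oo); but at w = 1 + s > 1 it is at least e^(kappa c) for some kappa > 0, by
   looking at a single term with k close to c s / 2.
   If there were no zero near w = 1, the logarithm of the function would have a Taylor expansion
   on a disc around 1 - s that contains 1 + s. By the Borel-Caratheodory inequality its
   coefficients are O(1) in terms of the small disc inside |w| < 1 and O(c) in terms of the large
   disc; using the first bound up to a large fixed order N and the second one beyond, the
   logarithm at 1 + s is at most O_N(1) + O(c 2^-N), a contradiction for large c.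
   The logarithm is only needed for the partial sums of the series, which inherit the absence of
   zeros by compactness: there it is a sum over the roots of ln |1 - z / s|. *)

Require Import Defs.
From Stdlib Require Import Reals Lra Lia ZArith Classical IndefiniteDescription.
From Coquelicot Require Import Coquelicot.
From mathcomp Require all_boot all_algebra Rstruct complex.
Open Scope R_scope.

(** * Factorization of complex polynomials *)

Module Factorization.
Import all_boot all_algebra Rstruct complex.
Import GRing.Theory.
Local Open Scope ring_scope.

(** Bridge between two models of the complex numbers: roots come from the algebraically closed field
    [complex R], the analysis takes place in [C]. *)
Definition of_complex (x : complex R) : C := (complex.Re x, complex.Im x).
Definition to_complex (z : C) : complex R := complex.Complex (fst z) (snd z).

Lemma of_complexK (z : C) : of_complex (to_complex z) = z.
Proof. by case: z. Qed.

Lemma of_complexD (x y : complex R) :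
  of_complex (x + y) = Cplus (of_complex x) (of_complex y).
Proof. by case: x; case: y. Qed.

Lemma of_complexM (x y : complex R) :
  of_complex (x * y) = Cmult (of_complex x) (of_complex y).
Proof. by case: x; case: y. Qed.

Lemma of_complexB (x y : complex R) :
  of_complex (x - y) = Cminus (of_complex x) (of_complex y).
Proof. by case: x; case: y. Qed.

Lemma of_complexX (x : complex R) k : of_complex (x ^+ k) = Cpow (of_complex x) k.
Proof. by elim: k => [//|k IH]; rewrite exprS of_complexM IH. Qed.

Lemma polynomial_factorization (p : nat -> C) (n : nat) :
  p n <> RtoC 0 ->
  exists l : list C, forall z : C,
    @sum_n C_AbelianMonoid (fun k => Cmult (p k) (Cpow z k)) n =
    Cmult (p n) (List.fold_right (fun s acc => Cmult (Cminus z s) acc) (RtoC 1) l).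
Proof.
move=> pn0.
set q : {poly complex R} := \poly_(k < n.+1) to_complex (p k).
have [r qE] := closed_field_poly_normal q.
exists (List.map of_complex r) => z.
have lead : lead_coef q = to_complex (p n).
  rewrite /q lead_coef_poly //=; apply/negP => /eqP pn; apply: pn0.
  by rewrite -[p n]of_complexK pn.
have -> : @sum_n C_AbelianMonoid (fun k => Cmult (p k) (Cpow z k)) n =
    of_complex q.[to_complex z].
  rewrite horner_poly; clear; elim: n => [|n IH].
    by rewrite sum_O big_ord1 of_complexM of_complexX !of_complexK.
  by rewrite big_ord_recr of_complexD -IH sum_Sn of_complexM of_complexX !of_complexK.
rewrite {}qE lead hornerZ of_complexM of_complexK; congr Cmult.
elim: r => [|x r IH]; first by rewrite big_nil hornerC.
by rewrite big_cons hornerM of_complexM IH hornerXsubC of_complexB of_complexK.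
Qed.

End Factorization.

(** * Logarithms and cosine polynomials *)

Ltac eq_R := match goal with |- @eq _ ?u ?v => change (@eq R u v) end.

Lemma Re_Cpow_SS (z : C) (k : nat) :
  Re (Cpow z (S (S k))) = 2 * Re z * Re (Cpow z (S k)) - Cmod z ^ 2 * Re (Cpow z k).
Proof.
  rewrite Cmod2_alt. simpl. destruct (Cpow z k) as [u v], z as [x y]. simpl. ring.
Qed.

(** Taylor coefficients of [ln (1 - z)] at 0. *)
Definition log_coef (k : nat) : R :=
  match k with O => 0 | S _ => - / INR k end.

(* The quotient is the real part of [- z^(K+1) t^K / (1 - t z)], the derivative at [t] of
   [ln |1 - t z|] minus its Taylor polynomial of degree [K]. *)
Lemma is_derive_log_remainder (z : C) (K : nat) (t : R) :
  0 < (1 - t * Re z) ^ 2 + (t * Im z) ^ 2 ->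
  is_derive (fun t => / 2 * ln ((1 - t * Re z) ^ 2 + (t * Im z) ^ 2)
                      - sum_f_R0 (fun k => log_coef k * Re (Cpow z k) * t ^ k) K) t
    (- t ^ K * (Re (Cpow z (S K)) - t * Cmod z ^ 2 * Re (Cpow z K))
       / ((1 - t * Re z) ^ 2 + (t * Im z) ^ 2)).
Proof.
  intros HD. induction K as [|K IH].
  - apply (is_derive_ext (fun t => / 2 * ln ((1 - t * Re z) ^ 2 + (t * Im z) ^ 2))).
    { intros u. simpl. ring. }
    auto_derive; [exact HD|].
    rewrite Cmod2_alt. destruct z as [x y]; simpl in *. field. lra.
  - apply (is_derive_ext (fun t => (/ 2 * ln ((1 - t * Re z) ^ 2 + (t * Im z) ^ 2)
        - sum_f_R0 (fun k => log_coef k * Re (Cpow z k) * t ^ k) K)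
        + / INR (S K) * Re (Cpow z (S K)) * t ^ S K)).
    { intros u. eq_R. rewrite tech5. change (log_coef (S K)) with (- / INR (S K)). ring. }
    rewrite Re_Cpow_SS.
    set (c1 := Re (Cpow z (S K))) in *. set (c0 := Re (Cpow z K)) in *.
    evar_last.
    { apply (is_derive_plus (V := R_NormedModule)); [exact IH|].
      apply (is_derive_scal (fun t => t ^ S K) t (/ INR (S K) * c1)).
      apply (is_derive_pow (fun t => t) (S K) t 1), (is_derive_id (K := R_AbsRing)). }
    assert (INR (S K) <> 0) by (apply not_0_INR; lia).
    rewrite Cmod2_alt in *. change (t ^ S K) with (t * t ^ K).
    eq_R.
    change (@plus R_NormedModule) with Rplus. change (@one R_AbsRing) with 1. simpl pred.
    field_simplify_eq; [|split; lra]. ring.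
Qed.

(** Mean value theorem along the segment [t z], [0 <= t <= 1]: the numerator of the derivative above
    is at most [2 * th ^ S K], its denominator at least [(1 - th) ^ 2]. *)
Lemma ln_Cmod_one_minus_approx (z : C) (th : R) (K : nat) :
  Cmod z <= th -> th < 1 ->
  Rabs (ln (Cmod (1 - z)) - sum_f_R0 (fun k => log_coef k * Re (Cpow z k)) K)
    <= 2 * th ^ S K / (1 - th) ^ 2.
Proof.
  intros Hz Hth. pose proof (Cmod_ge_0 z) as H0.
  pose proof (re_le_Cmod z) as Hre. apply Rabs_le_between in Hre.
  assert (HD : forall t, 0 <= t <= 1 ->
    (1 - th) ^ 2 <= (1 - t * Re z) ^ 2 + (t * Im z) ^ 2).
  { intros t Ht.
    assert (1 - th <= 1 - t * Re z) by nra.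
    pose proof (pow2_ge_0 (t * Im z)). nra. }
  set (h := fun t => / 2 * ln ((1 - t * Re z) ^ 2 + (t * Im z) ^ 2)
                      - sum_f_R0 (fun k => log_coef k * Re (Cpow z k) * t ^ k) K).
  assert (Hpos : 0 < (1 - th) ^ 2) by nra.
  destruct (MVT_gen h 0 1 (fun t => - t ^ K * (Re (Cpow z (S K)) - t * Cmod z ^ 2 * Re (Cpow z K))
       / ((1 - t * Re z) ^ 2 + (t * Im z) ^ 2))) as [t [Ht Ht']].
  { intros t Ht. rewrite Rmin_left, Rmax_right in Ht by lra.
    apply is_derive_log_remainder. specialize (HD t ltac:(lra)). lra. }
  { intros t Ht. rewrite Rmin_left, Rmax_right in Ht by lra.
    apply continuity_pt_filterlim, (ex_derive_continuous (V := R_NormedModule)).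
    eexists. apply is_derive_log_remainder. specialize (HD t ltac:(lra)). lra. }
  rewrite Rmin_left, Rmax_right in Ht by lra. specialize (HD t Ht).
  replace (ln (Cmod (1 - z)) - sum_f_R0 (fun k => log_coef k * Re (Cpow z k)) K)
    with (h 1 - h 0).
  - rewrite Ht'. unfold Rdiv. rewrite Rminus_0_r, Rmult_1_r, Rabs_mult.
    set (D := (1 - t * Re z) ^ 2 + (t * Im z) ^ 2) in *.
    rewrite (Rabs_inv D), (Rabs_right D) by lra.
    apply Rmult_le_compat; [apply Rabs_pos| | |apply Rinv_le_contravar; lra].
    { left. apply Rinv_0_lt_compat. lra. }
    assert (Hpow : forall k, Rabs (Re (Cpow z k)) <= th ^ k).
    { intros k. eapply Rle_trans; [apply re_le_Cmod|]. rewrite Cmod_pow.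
      apply pow_incr. lra. }
    rewrite Rabs_mult, Rabs_Ropp.
    assert (H1 : Rabs (t ^ K) <= 1).
    { rewrite <- RPow_abs, Rabs_right by lra. rewrite <- (pow1 K). apply pow_incr. lra. }
    assert (H2 : Rabs (Re (Cpow z (S K)) - t * Cmod z ^ 2 * Re (Cpow z K)) <= 2 * th ^ S K).
    { unfold Rminus. eapply Rle_trans; [apply Rabs_triang|]. rewrite Rabs_Ropp, Rabs_mult.
      pose proof (Hpow (S K)). pose proof (Hpow K).
      assert (0 <= t * Cmod z ^ 2 <= th).
      { split; [nra|]. assert (t * Cmod z ^ 2 <= 1 * Cmod z ^ 2) by nra. nra. }
      rewrite (Rabs_right (t * Cmod z ^ 2)) by lra.
      pose proof (Rabs_pos (Re (Cpow z K))).
      assert (t * Cmod z ^ 2 * Rabs (Re (Cpow z K)) <= th * th ^ K)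
        by (apply Rmult_le_compat; lra).
      simpl pow at 2. simpl pow in H. lra. }
    pose proof (Rabs_pos (t ^ K)).
    pose proof (Rabs_pos (Re (Cpow z (S K)) - t * Cmod z ^ 2 * Re (Cpow z K))). nra.
  - unfold h. rewrite !Rmult_0_l, Rminus_0_r.
    replace (1 ^ 2 + 0 ^ 2) with 1 by ring. rewrite ln_1.
    (* The only nonzero power of 0 is the one of order 0, and [log_coef 0 = 0]. *)
    assert (E0 : sum_f_R0 (fun k => log_coef k * Re (Cpow z k) * 0 ^ k) K = 0).
    { rewrite (sum_eq _ (fun _ => 0)); [rewrite sum_cte; ring|].
      intros [|i] _; simpl; ring. }
    assert (E1 : sum_f_R0 (fun k => log_coef k * Re (Cpow z k) * 1 ^ k) K
                 = sum_f_R0 (fun k => log_coef k * Re (Cpow z k)) K).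
    { apply sum_eq. intros. rewrite pow1. ring. }
    rewrite E0, E1, !Rmult_1_l.
    assert (HD1 : 0 < Cmod (1 - z)).
    { pose proof (Cmod_triangle (1 - z) z) as Htr.
      replace ((1 - z) + z)%C with (RtoC 1) in Htr by ring.
      rewrite Cmod_1 in Htr. lra. }
    replace ((1 - Re z) ^ 2 + Im z ^ 2) with (Cmod (1 - z) * Cmod (1 - z)).
    + rewrite ln_mult by easy. field.
    + replace (Cmod (1 - z) * Cmod (1 - z)) with (Cmod (1 - z) ^ 2) by ring.
      rewrite Cmod2_alt. destruct z; simpl; ring.
Qed.

(** * Cosine integrals over [[0, PI]] and extraction of coefficients *)

Definition cos_mass (m : Z) : R := if Z.eq_dec m 0 then PI else 0.

Lemma is_RInt_cos_IZR (m : Z) :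
  is_RInt (fun t => cos (IZR m * t)) 0 PI (cos_mass m).
Proof.
  unfold cos_mass. destruct (Z.eq_dec m 0) as [->|Hm].
  - apply (is_RInt_ext (fun _ => 1)).
    { intros. now rewrite Rmult_0_l, cos_0. }
    evar_last; [apply (is_RInt_const (V := R_NormedModule))|].
    unfold scal; simpl; unfold mult; simpl. ring.
  - assert (IZR m <> 0) by now apply not_0_IZR.
    evar_last.
    { apply (is_RInt_derive (fun t => sin (IZR m * t) / IZR m)).
      - intros. auto_derive; [easy|]. field; easy.
      - intros. apply (ex_derive_continuous (V := R_NormedModule)). auto_derive; easy. }
    unfold minus, plus, opp; simpl. rewrite Rmult_0_r, sin_0.
    rewrite (sin_eq_0_1 (IZR m * PI)); [field; easy|]. now exists m.
Qed.

Lemma is_RInt_cos_mul_kernel (k n : nat) :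
  is_RInt (fun t => cos (INR k * t) * (1 + cos (INR n * t))) 0 PI
    (cos_mass (Z.of_nat k)
     + / 2 * (cos_mass (Z.of_nat k + Z.of_nat n) + cos_mass (Z.of_nat k - Z.of_nat n))).
Proof.
  apply (is_RInt_ext (fun t => cos (IZR (Z.of_nat k) * t)
    + / 2 * (cos (IZR (Z.of_nat k + Z.of_nat n) * t)
             + cos (IZR (Z.of_nat k - Z.of_nat n) * t)))).
  { intros t _. rewrite plus_IZR, minus_IZR, <- !INR_IZR_INZ.
    rewrite Rmult_plus_distr_r, Rmult_minus_distr_r, cos_plus, cos_minus. eq_R. field. }
  apply (is_RInt_plus (V := R_NormedModule)); [apply is_RInt_cos_IZR|].
  apply (is_RInt_scal (V := R_NormedModule)).
  apply (is_RInt_plus (V := R_NormedModule)); apply is_RInt_cos_IZR.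
Qed.

(** Orthogonality of cosines: the 1 in the kernel extracts [x 0], and [cos (n t)] extracts [x n],
    which occurs only when [n <= K]. *)
Lemma is_RInt_cosine_polynomial (x : nat -> R) (n K : nat) :
  (1 <= n)%nat ->
  is_RInt (fun t => sum_f_R0 (fun k => x k * cos (INR k * t)) K * (1 + cos (INR n * t))) 0 PI
    (PI * x O + (if le_dec n K then PI / 2 * x n else 0)).
Proof.
  intros Hn. induction K as [|K IH].
  - apply (is_RInt_ext (fun t => x O * (cos (INR 0 * t) * (1 + cos (INR n * t))))).
    { intros. eq_R. simpl. ring. }
    evar_last; [apply (is_RInt_scal (V := R_NormedModule)), is_RInt_cos_mul_kernel|].
    unfold scal; simpl; unfold mult; simpl. unfold cos_mass.
    repeat destruct Z.eq_dec; destruct le_dec; try lia; lra.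
  - apply (is_RInt_ext (fun t =>
      sum_f_R0 (fun k => x k * cos (INR k * t)) K * (1 + cos (INR n * t))
      + x (S K) * (cos (INR (S K) * t) * (1 + cos (INR n * t))))).
    { intros t _. eq_R. rewrite tech5. ring. }
    evar_last.
    { apply (is_RInt_plus (V := R_NormedModule)); [exact IH|].
      apply (is_RInt_scal (V := R_NormedModule)), is_RInt_cos_mul_kernel. }
    change (@plus R_NormedModule) with Rplus. change (@scal _ R_NormedModule) with Rmult.
    unfold cos_mass.
    repeat destruct Z.eq_dec; repeat destruct le_dec; try lia; try lra.
    replace n with (S K) by lia. lra.
Qed.

(* Integrate [M - T >= 0] against the kernel [1 + cos (n t) >= 0]. *)
Lemma cosine_polynomial_coef_le (x : nat -> R) (K n : nat) (M : R) :
  (forall t, sum_f_R0 (fun k => x k * cos (INR k * t)) K <= M) ->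
  (1 <= n <= K)%nat -> x n <= 2 * (M - x O).
Proof.
  intros HM Hn.
  assert (HI := is_RInt_cosine_polynomial x n K ltac:(lia)).
  destruct (le_dec n K) as [_|]; [|lia].
  (* The constant [M] as a cosine polynomial of degree 0: its integral against the kernel is
     [PI * M]. *)
  assert (HJ := is_RInt_cosine_polynomial (fun _ => M) n 0 ltac:(lia)).
  destruct (le_dec n 0) as [|_]; [lia|].
  pose proof PI_RGT_0.
  assert (PI * x O + PI / 2 * x n <= PI * M + 0); [|nra].
  apply (is_RInt_le _ _ 0 PI _ _ ltac:(lra) HI HJ).
  intros t _. unfold sum_f_R0 at 2. rewrite Rmult_0_l, cos_0.
  apply Rmult_le_compat_r; [|rewrite Rmult_1_r; apply HM].
  pose proof (COS_bound (INR n * t)). lra.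
Qed.

(** * Expansion of the logarithm of a zero-free polynomial *)

(** Uniform expansion of [U] as the real part of a power series. Working with real parts avoids
    choosing a branch of the complex logarithm. *)
Definition re_series_on_disc (U : C -> R) (b : nat -> C) (r : R) : Prop :=
  forall eps, 0 < eps -> exists K0, forall K z, (K0 <= K)%nat -> Cmod z <= r ->
    Rabs (U z - sum_f_R0 (fun k => Re (b k * Cpow z k)) K) <= eps.

Lemma re_series_const (c r : R) :
  re_series_on_disc (fun _ => c) (fun k => match k with O => RtoC c | S _ => RtoC 0 end) r.
Proof.
  intros eps Heps. exists O. intros K z _ _.
  replace (sum_f_R0 _ K) with c; [rewrite Rminus_diag, Rabs_R0; lra|].
  induction K as [|K IH]; [simpl; ring|].
  rewrite tech5, <- IH, Cmult_0_l. simpl. ring.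
Qed.

Lemma re_series_plus (U V : C -> R) (b c : nat -> C) (r : R) :
  re_series_on_disc U b r -> re_series_on_disc V c r ->
  re_series_on_disc (fun z => U z + V z) (fun k => b k + c k)%C r.
Proof.
  intros HU HV eps Heps.
  destruct (HU (eps / 2) ltac:(lra)) as [K1 H1].
  destruct (HV (eps / 2) ltac:(lra)) as [K2 H2].
  exists (Nat.max K1 K2). intros K z HK Hz.
  specialize (H1 K z ltac:(lia) Hz). specialize (H2 K z ltac:(lia) Hz).
  rewrite (sum_eq _ (fun k => Re (b k * Cpow z k) + Re (c k * Cpow z k))).
  - rewrite sum_plus. apply Rabs_le_between in H1, H2. apply Rabs_le_between. lra.
  - intros i _. rewrite <- re_plus. f_equal. ring.
Qed.

Lemma re_series_ext (U V : C -> R) (b : nat -> C) (r : R) :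
  (forall z, Cmod z <= r -> U z = V z) ->
  re_series_on_disc U b r -> re_series_on_disc V b r.
Proof.
  intros He HU eps Heps. destruct (HU eps Heps) as [K0 HK]. exists K0.
  intros K z H1 H2. rewrite <- He by easy. now apply HK.
Qed.

Lemma re_series_ln_one_minus (s : C) (r : R) :
  0 <= r < Cmod s ->
  re_series_on_disc (fun z => ln (Cmod (1 - z / s))) (fun k => log_coef k * Cpow (/ s) k)%C r.
Proof.
  intros Hr eps Heps. set (th := r / Cmod s).
  assert (Hs : s <> RtoC 0).
  { intros ->. rewrite Cmod_0 in Hr. lra. }
  assert (Hth : 0 <= th < 1).
  { unfold th. split; [apply Rdiv_le_0_compat; lra|].
    apply Rmult_lt_reg_r with (Cmod s); [lra|]. unfold Rdiv.
    rewrite Rmult_assoc, Rinv_l; lra. }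
  assert (Hpos : 0 < (1 - th) ^ 2) by (apply pow_lt; lra).
  destruct (pow_lt_1_zero th ltac:(rewrite Rabs_right; lra) (eps * (1 - th) ^ 2 / 2))
    as [K0 HK0]; [apply Rdiv_lt_0_compat; [now apply Rmult_lt_0_compat|lra]|].
  exists K0. intros K z HK Hz.
  assert (Hzs : Cmod (z / s) <= th).
  { rewrite Cmod_div by easy. unfold th. apply Rmult_le_compat_r; [|easy].
    left. apply Rinv_0_lt_compat. lra. }
  rewrite (sum_eq _ (fun k => log_coef k * Re (Cpow (z / s) k))).
  - eapply Rle_trans; [apply (ln_Cmod_one_minus_approx _ th); lra|].
    specialize (HK0 (S K) ltac:(lia)). apply Rabs_def2 in HK0.
    apply Rmult_le_reg_r with ((1 - th) ^ 2); [easy|].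
    unfold Rdiv. rewrite Rmult_assoc, Rinv_l; lra.
  - intros i _. unfold Cdiv. rewrite Cpow_mult_l, <- re_scal_l. f_equal. ring.
Qed.

(** Induction on the roots: [x0 + z - s] equals [-(s - x0) * (1 - z / (s - x0))], so each root adds
    a constant and a logarithmic series, which converges because the root is farther than [r] from
    [x0]. *)
Lemma re_series_ln_root_product (c x0 : C) (r : R) (l : list C) :
  0 <= r ->
  (forall z, Cmod z <= r ->
    Cmult c (List.fold_right (fun s acc => (x0 + z - s) * acc)%C (RtoC 1) l) <> RtoC 0) ->
  exists b, re_series_on_disc
    (fun z => ln (Cmod (c * List.fold_right (fun s acc => (x0 + z - s) * acc)%C (RtoC 1) l)))
    b r.
Proof.
  intros Hr. induction l as [|s l IH]; intros Hnz; simpl in *.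
  - eexists. apply re_series_const with (c := ln (Cmod (c * 1))).
  - destruct IH as [b Hb].
    { intros z Hz E. apply (Hnz z Hz).
      transitivity ((x0 + z - s) * RtoC 0)%C; [rewrite <- E; ring|ring]. }
    (* Otherwise [z = s - x0] would be a zero in the disc. *)
    assert (Hs : r < Cmod (s - x0)).
    { apply Rnot_le_lt. intros Hle. apply (Hnz _ Hle). ring. }
    assert (Hs0 : (s - x0)%C <> RtoC 0).
    { intros E. rewrite E, Cmod_0 in Hs. lra. }
    eexists. eapply re_series_ext; [|apply re_series_plus; [exact Hb|apply re_series_plus;
      [apply re_series_const with (c := ln (Cmod (s - x0)))
      |apply (re_series_ln_one_minus (s - x0)); lra]]].
    intros z Hz. specialize (Hnz z Hz). simpl.
    assert (E : (x0 + z - s)%C = (- ((s - x0) * (1 - z / (s - x0))))%C) by (field; easy).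
    rewrite E in *.
    set (F := List.fold_right _ _ _) in *.
    assert (c <> RtoC 0) by (intros E'; apply Hnz; rewrite E'; ring).
    assert (F <> RtoC 0) by (intros E'; apply Hnz; rewrite E'; ring).
    assert ((1 - z / (s - x0))%C <> RtoC 0) by (intros E'; apply Hnz; rewrite E'; ring).
    rewrite !Cmod_mult, Cmod_opp, Cmod_mult.
    rewrite !ln_mult; try ring; repeat apply Rmult_lt_0_compat; now apply Cmod_gt_0.
Qed.

(** * Coefficient bounds from one-sided bounds on the real part *)

Lemma Cpow_polar (rho t : R) (k : nat) :
  Cpow (rho * cos t, rho * sin t) k = (rho ^ k * cos (INR k * t), rho ^ k * sin (INR k * t)).
Proof.
  induction k as [|k IH].
  - simpl. rewrite Rmult_0_l, cos_0, sin_0. unfold RtoC. f_equal; ring.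
  - rewrite Cpow_S, IH, S_INR, Rmult_plus_distr_r, Rmult_1_l, cos_plus, sin_plus.
    unfold Cmult; simpl. f_equal; ring.
Qed.

Lemma Cmod_polar (rho t : R) : 0 <= rho -> Cmod (rho * cos t, rho * sin t) = rho.
Proof.
  intros H. unfold Cmod. cbn [fst snd].
  transitivity (sqrt (rho ^ 2)); [f_equal|now apply sqrt_pow2].
  pose proof (sin2_cos2 t) as E. unfold Rsqr in E.
  transitivity (rho ^ 2 * (sin t * sin t + cos t * cos t)); [ring|rewrite E; ring].
Qed.

Lemma re_series_at_0 (b : nat -> C) (K : nat) :
  sum_f_R0 (fun k => Re (b k * Cpow 0 k)) K = Re (b O).
Proof.
  induction K as [|K IH].
  - cbn [sum_f_R0 Cpow]. now rewrite Cmult_1_r.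
  - rewrite tech5, IH, Cpow_S, Cmult_0_l, Cmult_0_r. simpl. ring.
Qed.

(** Borel-Caratheodory inequality: averaging the expansion over the points of the circle at angles
    [t] and [-t] leaves a cosine polynomial with coefficients [Re (b k) * rho ^ k]. Bounding
    [Re (b n)] from above is enough for evaluation at a point [d >= 0]. *)
Lemma re_series_coef_le (U : C -> R) (b : nat -> C) (r rho M : R) (n : nat) :
  re_series_on_disc U b r -> 0 <= rho <= r ->
  (forall z, Cmod z <= rho -> U z <= M) -> (1 <= n)%nat ->
  Re (b n) * rho ^ n <= 2 * (M - U (RtoC 0)).
Proof.
  intros HU Hrho HM Hn. apply le_epsilon. intros eps Heps.
  (* The error enters once through [M] and once through [U 0], and both are doubled. *)
  destruct (HU (eps / 4) ltac:(lra)) as [K0 HK].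
  set (K := Nat.max K0 n).
  assert (H0 := HK K (RtoC 0) ltac:(lia) ltac:(rewrite Cmod_0; lra)).
  rewrite re_series_at_0 in H0. apply Rabs_le_between in H0.
  assert (Hc := cosine_polynomial_coef_le (fun k => Re (b k) * rho ^ k) K n (M + eps / 4)).
  cbv beta in Hc. rewrite pow_O, Rmult_1_r in Hc.
  enough (Re (b n) * rho ^ n <= 2 * (M + eps / 4 - Re (b O))) by lra.
  apply Hc; [|lia]. clear Hc. intros t.
  assert (Ht : forall t, Cmod (rho * cos t, rho * sin t) <= rho).
  { intros. rewrite Cmod_polar; lra. }
  assert (H1 := HK K (rho * cos t, rho * sin t) ltac:(lia) ltac:(specialize (Ht t); lra)).
  assert (H2 := HK K (rho * cos (- t), rho * sin (- t)) ltac:(lia)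
    ltac:(specialize (Ht (- t)); lra)).
  assert (HM1 := HM _ (Ht t)). assert (HM2 := HM _ (Ht (- t))).
  apply Rabs_le_between in H1, H2.
  enough (2 * sum_f_R0 (fun k => Re (b k) * rho ^ k * cos (INR k * t)) K
    = sum_f_R0 (fun k => Re (b k * Cpow (rho * cos t, rho * sin t) k)) K
      + sum_f_R0 (fun k => Re (b k * Cpow (rho * cos (- t), rho * sin (- t)) k)) K) by lra.
  rewrite scal_sum, <- sum_plus. apply sum_eq. intros i _.
  rewrite !Cpow_polar, !re_mult. simpl Re. simpl Im.
  rewrite <- Ropp_mult_distr_r, cos_neg, sin_neg. ring.
Qed.

(* The Taylor coefficients are controlled by the small bound [m] up to order [N], and by
   the large bound [M] on the larger disc beyond that order. *)
Lemma re_series_two_disc_bound (U : C -> R) (b : nat -> C) (rho R0 d m M : R) (N : nat) :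
  re_series_on_disc U b R0 -> 0 < rho <= R0 -> 0 <= d < R0 ->
  (forall z, Cmod z <= rho -> U z <= m) ->
  (forall z, Cmod z <= R0 -> U z <= M) ->
  0 <= U (RtoC 0) ->
  U (RtoC d) <= m + 2 * m * sum_f_R0 (fun k => (d / rho) ^ k) N
                + 2 * M * ((d / R0) ^ S N / (1 - d / R0)).
Proof.
  intros HU Hrho Hd Hm HM H0. apply le_epsilon. intros eps Heps.
  destruct (HU (eps / 2) ltac:(lra)) as [K0 HK].
  assert (Hm0 : U (RtoC 0) <= m) by (apply Hm; rewrite Cmod_0; lra).
  assert (HM0 : U (RtoC 0) <= M) by (apply HM; rewrite Cmod_0; lra).
  assert (HbO : Re (b O) <= m + eps / 2).
  { specialize (HK K0 (RtoC 0) ltac:(lia) ltac:(rewrite Cmod_0; lra)).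
    rewrite re_series_at_0 in HK. apply Rabs_le_between in HK. lra. }
  (* Since [U 0 >= 0], the bound [2 * (B - U 0)] may be replaced by [2 * B]. *)
  assert (Hcoef : forall rad B n, 0 < rad <= R0 ->
    (forall z, Cmod z <= rad -> U z <= B) -> (1 <= n)%nat ->
    Re (b n * Cpow d n) <= 2 * B * (d / rad) ^ n).
  { intros rad B n Hrad HB Hn.
    assert (Hc := re_series_coef_le U b R0 rad B n HU ltac:(lra) HB Hn).
    rewrite <- RtoC_pow, re_scal_r.
    assert (Hp : 0 < rad ^ n) by (apply pow_lt; lra).
    assert (Hdn : 0 <= d ^ n) by (apply pow_le; lra).
    unfold Rdiv. rewrite Rpow_mult_distr, pow_inv.
    assert (Re (b n) <= 2 * B * / rad ^ n).
    { apply Rmult_le_reg_r with (rad ^ n); [easy|].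
      rewrite (Rmult_assoc (2 * B)), Rinv_l by lra. lra. }
    replace (2 * B * (d ^ n * / rad ^ n)) with (2 * B * / rad ^ n * d ^ n) by ring.
    now apply Rmult_le_compat_r. }
  set (q := d / R0) in *.
  assert (Hq : 0 <= q < 1).
  { unfold q. split; [apply Rdiv_le_0_compat; lra|].
    apply Rmult_lt_reg_r with R0; [lra|]. unfold Rdiv.
    rewrite Rmult_assoc, Rinv_l; lra. }
  assert (Hlow : forall j, sum_f_R0 (fun k => Re (b k * Cpow d k)) j
    <= m + eps / 2 + 2 * m * sum_f_R0 (fun k => (d / rho) ^ k) j).
  { induction j as [|j IH].
    - cbn [sum_f_R0 Cpow pow]. rewrite Cmult_1_r. lra.
    - rewrite !tech5.
      specialize (Hcoef rho m (S j) ltac:(lra) Hm ltac:(lia)). lra. }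
  (* The last quotient is the closed form of the geometric sum of [q ^ k] for [N < k <= N + j]. *)
  assert (Hhigh : forall j, sum_f_R0 (fun k => Re (b k * Cpow d k)) (N + j)
    <= m + eps / 2 + 2 * m * sum_f_R0 (fun k => (d / rho) ^ k) N
       + 2 * M * ((q ^ S N - q ^ S (N + j)) / (1 - q))).
  { induction j as [|j IH].
    - rewrite Nat.add_0_r, Rminus_diag. specialize (Hlow N). unfold Rdiv at 3. lra.
    - rewrite Nat.add_succ_r, tech5.
      specialize (Hcoef R0 M (S (N + j)) ltac:(lra) HM ltac:(lia)). fold q in Hcoef.
      replace (2 * M * ((q ^ S N - q ^ S (S (N + j))) / (1 - q))) with
        (2 * M * ((q ^ S N - q ^ S (N + j)) / (1 - q)) + 2 * M * q ^ S (N + j));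
        [lra|].
      simpl. field. lra. }
  specialize (Hhigh K0).
  specialize (HK (N + K0)%nat (RtoC d) ltac:(lia) ltac:(rewrite Cmod_R, Rabs_right; lra)).
  apply Rabs_le_between in HK.
  assert (2 * M * ((q ^ S N - q ^ S (N + K0)) / (1 - q)) <= 2 * M * (q ^ S N / (1 - q))).
  { apply Rmult_le_compat_l; [lra|]. apply Rmult_le_compat_r.
    - left. apply Rinv_0_lt_compat. lra.
    - pose proof (pow_le q (S (N + K0)) ltac:(lra)). lra. }
  lra.
Qed.

(** * Power series with nonnegative coefficients *)

Definition cpoly (t : nat -> R) (n : nat) (w : C) : C :=
  @sum_n C_AbelianMonoid (fun k => Cmult (RtoC (t k)) (Cpow w k)) n.

(** The two-disc bound for the logarithm of the modulus, centred at [x0]; the lower bound 1 at [x0]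
    makes the logarithm nonnegative there. *)
Lemma cpoly_ln_two_disc_bound (t : nat -> R) (n : nat) (x0 rho R0 d A B : R) (N : nat) :
  t n <> 0 -> 0 < rho <= R0 -> 0 <= d < R0 ->
  (forall z, Cmod z <= R0 -> cpoly t n (x0 + z) <> RtoC 0) ->
  (forall z, Cmod z <= rho -> Cmod (cpoly t n (x0 + z)) <= A) ->
  (forall z, Cmod z <= R0 -> Cmod (cpoly t n (x0 + z)) <= B) ->
  1 <= Cmod (cpoly t n x0) ->
  ln (Cmod (cpoly t n (x0 + d))) <=
    ln A + 2 * ln A * sum_f_R0 (fun k => (d / rho) ^ k) N
    + 2 * ln B * ((d / R0) ^ S N / (1 - d / R0)).
Proof.
  intros Ht Hrho Hd Hnz HA HB H1.
  destruct (Factorization.polynomial_factorization (fun k => RtoC (t k)) n) as [l Hl].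
  { intros E. apply Ht. now injection E. }
  destruct (re_series_ln_root_product (RtoC (t n)) x0 R0 l ltac:(lra)) as [b Hb].
  { intros z Hz. rewrite <- Hl. now apply Hnz. }
  apply (re_series_ext _ (fun z => ln (Cmod (cpoly t n (x0 + z))))) in Hb.
  2:{ intros z _. unfold cpoly. now rewrite Hl. }
  apply (re_series_two_disc_bound (fun z => ln (Cmod (cpoly t n (x0 + z)))) b rho R0 d
    (ln A) (ln B) N Hb Hrho Hd).
  - intros z Hz. apply ln_le; [|now apply HA]. apply Cmod_gt_0, Hnz. lra.
  - intros z Hz. apply ln_le; [|now apply HB]. now apply Cmod_gt_0, Hnz.
  - rewrite Cplus_0_r. rewrite <- ln_1. apply ln_le; lra.
Qed.

Lemma partial_sum_le_Series (u : nat -> R) (n : nat) :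
  (forall k, 0 <= u k) -> ex_series u -> sum_f_R0 u n <= Series u.
Proof.
  intros Hu Hs. apply Series_correct, is_series_Reals in Hs.
  apply growing_ineq; [|exact Hs]. intros k. rewrite tech5. specialize (Hu (S k)). lra.
Qed.

Lemma Cmod_cpoly_le (t : nat -> R) (n : nat) (w : C) (X : R) :
  (forall k, 0 <= t k) -> Cmod w <= X ->
  Cmod (cpoly t n w) <= sum_f_R0 (fun k => t k * X ^ k) n.
Proof.
  intros Ht Hw. pose proof (Cmod_ge_0 w). unfold cpoly.
  assert (Hterm : forall k, Cmod (Cmult (RtoC (t k)) (Cpow w k)) <= t k * X ^ k).
  { intros k. rewrite Cmod_mult, Cmod_R, Cmod_pow, Rabs_right by (apply Rle_ge, Ht).
    apply Rmult_le_compat_l; [easy|]. now apply pow_incr. }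
  induction n as [|n IH].
  - rewrite sum_O. apply (Hterm O).
  - rewrite sum_Sn. rewrite tech5. eapply Rle_trans; [apply Cmod_triangle|].
    apply Rplus_le_compat; [exact IH|apply Hterm].
Qed.

Lemma cpoly_RtoC (t : nat -> R) (n : nat) (x : R) :
  cpoly t n x = RtoC (sum_f_R0 (fun k => t k * x ^ k) n).
Proof.
  unfold cpoly. induction n as [|n IH].
  - rewrite sum_O. cbn [sum_f_R0]. rewrite RtoC_mult, RtoC_pow. reflexivity.
  - rewrite sum_Sn, IH, tech5, RtoC_plus, RtoC_mult, RtoC_pow. reflexivity.
Qed.

Lemma Cmod_cpoly_add_sub_le (t : nat -> R) (n m : nat) (w : C) (X : R) :
  (forall k, 0 <= t k) -> Cmod w <= X ->
  Cmod (cpoly t (n + m) w - cpoly t n w) <=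
    sum_f_R0 (fun k => t k * X ^ k) (n + m) - sum_f_R0 (fun k => t k * X ^ k) n.
Proof.
  intros Ht Hw. pose proof (Cmod_ge_0 w). induction m as [|m IH].
  - rewrite Nat.add_0_r, Rminus_diag. unfold Cminus. rewrite Cplus_opp_r, Cmod_0. lra.
  - rewrite Nat.add_succ_r, tech5. unfold cpoly at 1. rewrite sum_Sn. fold (cpoly t (n + m) w).
    change (@plus C_AbelianMonoid) with Cplus.
    set (v := Cmult (RtoC _) _).
    replace (cpoly t (n + m) w + v - cpoly t n w)%C
      with ((cpoly t (n + m) w - cpoly t n w) + v)%C by ring.
    eapply Rle_trans; [apply Cmod_triangle|].
    assert (Cmod v <= t (S (n + m)) * X ^ S (n + m)).
    { unfold v. rewrite Cmod_mult, Cmod_R, Cmod_pow, Rabs_right by (apply Rle_ge, Ht).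
      apply Rmult_le_compat_l; [easy|]. now apply pow_incr. }
    lra.
Qed.

Definition is_cseries (t : nat -> R) (w v : C) : Prop :=
  @is_series C_AbsRing C_NormedModule (fun k => Cmult (RtoC (t k)) (Cpow w k)) v.

(** Limit of the preceding block estimate as the upper index grows. The bound does not depend on
    [w], so convergence is uniform on the disc of radius [X]. *)
Lemma is_cseries_tail_le (t : nat -> R) (n : nat) (w v : C) (X : R) :
  (forall k, 0 <= t k) -> Cmod w <= X -> ex_series (fun k => t k * X ^ k) ->
  is_cseries t w v ->
  Cmod (v - cpoly t n w) <=
    Series (fun k => t k * X ^ k) - sum_f_R0 (fun k => t k * X ^ k) n.
Proof.
  intros Ht Hw Hex Hv. apply le_epsilon. intros eps Heps.
  destruct (proj1 (filterlim_locally_ball_norm (K := C_AbsRing) (U := C_NormedModule) _ _) Hv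
    (mkposreal _ Heps)) as [m Hm].
  specialize (Hm (n + m)%nat ltac:(lia)).
  change (Cmod (cpoly t (n + m) w - v) < eps) in Hm.
  pose proof (Cmod_cpoly_add_sub_le t n m w X Ht Hw).
  assert (sum_f_R0 (fun k => t k * X ^ k) (n + m) <= Series (fun k => t k * X ^ k)).
  { apply partial_sum_le_Series; [|easy]. intros k.
    apply Rmult_le_pos; [easy|]. apply pow_le. pose proof (Cmod_ge_0 w). lra. }
  replace (v - cpoly t n w)%C
    with ((cpoly t (n + m) w - cpoly t n w) + - (cpoly t (n + m) w - v))%C by ring.
  eapply Rle_trans; [apply Cmod_triangle|]. rewrite Cmod_opp. lra.
Qed.

Lemma ex_cseries (t : nat -> R) (w : C) (X : R) :
  (forall k, 0 <= t k) -> Cmod w <= X -> ex_series (fun k => t k * X ^ k) ->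
  exists v, is_cseries t w v.
Proof.
  intros Ht Hw Hex.
  apply (ex_series_le (K := C_AbsRing) (V := C_CompleteNormedModule) _ (fun k => t k * X ^ k));
    [|exact Hex].
  intros k. change (Cmod (Cmult (RtoC (t k)) (Cpow w k)) <= t k * X ^ k).
  rewrite Cmod_mult, Cmod_R, Cmod_pow, Rabs_right by (apply Rle_ge, Ht).
  apply Rmult_le_compat_l; [easy|]. apply pow_incr. split; [apply Cmod_ge_0|easy].
Qed.

(** * Passing absence of zeros from a series to its partial sums *)

Lemma Cpow_Lipschitz (X : R) (k : nat) :
  exists L, 0 <= L /\ forall w w', Cmod w <= X -> Cmod w' <= X ->
    Cmod (Cpow w' k - Cpow w k) <= L * Cmod (w' - w).
Proof.
  destruct (Rle_dec 0 X) as [HX|HX].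
  2:{ exists 0. split; [lra|]. intros w ? Hw. pose proof (Cmod_ge_0 w). lra. }
  induction k as [|k (L & HL & IH)].
  - exists 0. split; [lra|]. intros w w' _ _. simpl. unfold Cminus.
    rewrite Cplus_opp_r, Cmod_0. lra.
  - exists (X * L + X ^ k). split.
    { pose proof (pow_le X k HX). nra. }
    intros w w' Hw Hw'. rewrite !Cpow_S.
    replace (w' * Cpow w' k - w * Cpow w k)%C
      with (w' * (Cpow w' k - Cpow w k) + Cpow w k * (w' - w))%C by ring.
    eapply Rle_trans; [apply Cmod_triangle|]. rewrite !Cmod_mult, Cmod_pow.
    rewrite Rmult_plus_distr_r. apply Rplus_le_compat.
    + rewrite Rmult_assoc. apply Rmult_le_compat; auto using Cmod_ge_0.
    + apply Rmult_le_compat_r; [apply Cmod_ge_0|]. apply pow_incr. auto using Cmod_ge_0.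
Qed.

Lemma cpoly_Lipschitz (t : nat -> R) (n : nat) (X : R) :
  exists L, 0 <= L /\ forall w w', Cmod w <= X -> Cmod w' <= X ->
    Cmod (cpoly t n w' - cpoly t n w) <= L * Cmod (w' - w).
Proof.
  unfold cpoly. induction n as [|n (L & HL & IH)].
  - exists 0. split; [lra|]. intros w w' _ _. rewrite !sum_O. simpl. unfold Cminus.
    rewrite Cplus_opp_r, Cmod_0. lra.
  - destruct (Cpow_Lipschitz X (S n)) as (L' & HL' & Hpow).
    exists (L + Rabs (t (S n)) * L'). pose proof (Rabs_pos (t (S n))). split; [nra|].
    intros w w' Hw Hw'. rewrite !sum_Sn. change (@plus C_AbelianMonoid) with Cplus.
    set (p := sum_n _ n). set (q := sum_n _ n).
    replace (p + t (S n) * Cpow w' (S n) - (q + t (S n) * Cpow w (S n)))%C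
      with ((p - q) + t (S n) * (Cpow w' (S n) - Cpow w (S n)))%C by ring.
    eapply Rle_trans; [apply Cmod_triangle|]. rewrite Cmod_mult, Cmod_R.
    rewrite Rmult_plus_distr_r. apply Rplus_le_compat; [now apply IH|].
    rewrite Rmult_assoc. apply Rmult_le_compat_l; [easy|]. now apply Hpow.
Qed.

(** Compactness gives a positive lower bound for the modulus of [F] on the square; uniform
    convergence then keeps late partial sums away from 0. A square fits the compactness principle
    for rectangles. *)
Lemma cpoly_zero_free_on_square (t : nat -> R) (F : C -> C) (x y h X : R) :
  (forall k, 0 <= t k) -> ex_series (fun k => t k * X ^ k) ->
  (forall u v, Rabs (u - x) <= h -> Rabs (v - y) <= h -> Cmod (u, v) <= X) ->
  (forall w, Cmod w <= X -> is_cseries t w (F w)) ->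
  (forall u v, Rabs (u - x) <= h -> Rabs (v - y) <= h -> F (u, v) <> RtoC 0) ->
  exists n0, forall n u v, (n0 <= n)%nat -> Rabs (u - x) <= h -> Rabs (v - y) <= h ->
    cpoly t n (u, v) <> RtoC 0.
Proof.
  intros Ht Hex HX HF Hnz.
  set (sq := fun u v => Rabs (u - x) <= h /\ Rabs (v - y) <= h).
  assert (Htail : forall eps, 0 < eps -> exists n0, forall n u v, (n0 <= n)%nat -> sq u v ->
    Cmod (F (u, v) - cpoly t n (u, v)) <= eps).
  { intros eps Heps.
    assert (Hs := Series_correct _ Hex). apply is_series_Reals in Hs.
    destruct (Hs eps Heps) as [n0 Hn0]. exists n0. intros n u v Hn [Hu Hv].
    specialize (Hn0 n Hn). unfold Rdist in Hn0. apply Rabs_def2 in Hn0.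
    eapply Rle_trans; [apply (is_cseries_tail_le t n _ _ X); auto|]. lra. }
  assert (Htri : forall p q, Cmod p - Cmod (p - q) <= Cmod q).
  { intros p q. pose proof (Cmod_triangle (p - q) q) as H.
    replace (p - q + q)%C with p in H by ring. lra. }
  (* One number serves as radius of the neighbourhood and as lower bound on it, so a single gauge
     carries both. *)
  assert (Hloc : forall u v, exists delta : posreal, sq u v ->
    forall u' v', sq u' v' -> Rabs (u' - u) < delta -> Rabs (v' - v) < delta ->
      delta <= Cmod (F (u', v'))).
  { intros u v. destruct (classic (sq u v)) as [Hsq|]; [|now exists (mkposreal 1 Rlt_0_1)].
    assert (Hpos : 0 < Cmod (F (u, v))) by (apply Cmod_gt_0; apply Hnz; apply Hsq).
    (* Moving from [(u, v)] to [(u', v')] costs two tail errors and one Lipschitz error, each at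
       most [e]; this leaves [3 * e], above the chosen radius. *)
    set (e := Cmod (F (u, v)) / 6). assert (He : 0 < e) by (unfold e; lra).
    destruct (Htail e He) as [n Hn].
    destruct (cpoly_Lipschitz t n X) as (L & HL & HLip).
    assert (Hm : 0 < Rmin (e / (2 * (L + 1))) e).
    { apply Rmin_pos; [apply Rdiv_lt_0_compat; lra|easy]. }
    exists (mkposreal _ Hm). simpl. intros _ u' v' Hsq' Hu Hv.
    set (del := e / (2 * (L + 1))) in *.
    assert (Hdel : 2 * L * del <= e).
    { assert (2 * (L + 1) * del = e) by (unfold del; field; lra).
      assert (0 < del) by (unfold del; apply Rdiv_lt_0_compat; lra). lra. }
    pose proof (Rmin_l del e). pose proof (Rmin_r del e).
    assert (Hw : Cmod ((u', v') - (u, v)) <= 2 * del).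
    { replace ((u', v') - (u, v))%C with (RtoC (u' - u) + Ci * RtoC (v' - v))%C
        by (unfold RtoC, Ci, Cminus, Cplus, Copp, Cmult; simpl; f_equal; ring).
      eapply Rle_trans; [apply Cmod_triangle|].
      rewrite Cmod_mult, Cmod_Ci, !Cmod_R. lra. }
    assert (Hb : Cmod (cpoly t n (u', v') - cpoly t n (u, v)) <= e).
    { eapply Rle_trans; [apply HLip; apply HX; first [apply Hsq|apply Hsq']|].
      pose proof (Rmult_le_compat_l L _ _ HL Hw). lra. }
    pose proof (Htri (cpoly t n (u, v)) (cpoly t n (u', v'))) as H6.
    replace (cpoly t n (u, v) - cpoly t n (u', v'))%C
      with (- (cpoly t n (u', v') - cpoly t n (u, v)))%C in H6 by ring.
    rewrite Cmod_opp in H6.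
    pose proof (Hn n u v (le_n n) Hsq). pose proof (Hn n u' v' (le_n n) Hsq').
    pose proof (Htri (F (u, v)) (cpoly t n (u, v))).
    pose proof (Htri (cpoly t n (u', v')) (F (u', v'))) as H5.
    replace (cpoly t n (u', v') - F (u', v'))%C with (- (F (u', v') - cpoly t n (u', v')))%C
      in H5 by ring.
    rewrite Cmod_opp in H5.
    assert (Cmod (F (u, v)) = 6 * e) by (unfold e; field). lra. }
  assert (Hchoice : exists delta : R * R -> posreal, forall p, sq (fst p) (snd p) ->
    forall u' v', sq u' v' -> Rabs (u' - fst p) < delta p -> Rabs (v' - snd p) < delta p ->
      delta p <= Cmod (F (u', v'))).
  { apply (functional_choice (fun (p : R * R) (delta : posreal) => sq (fst p) (snd p) ->
      forall u' v', sq u' v' -> Rabs (u' - fst p) < delta -> Rabs (v' - snd p) < delta ->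
      delta <= Cmod (F (u', v')))).
    intros [u v]. apply Hloc. }
  destruct Hchoice as [delta Hdelta].
  destruct (compactness_value_2d (x - h) (x + h) (y - h) (y + h) (fun u v => delta (u, v)))
    as [d Hd].
  assert (Hlow : forall u v, sq u v -> d <= Cmod (F (u, v))).
  { intros u v [Hu Hv]. apply Rnot_lt_le. intros Hlt.
    assert (Hu' := proj1 (Rabs_le_between _ _) Hu).
    assert (Hv' := proj1 (Rabs_le_between _ _) Hv).
    apply (Hd u v ltac:(lra) ltac:(lra)). intros (u0 & v0 & Hu0 & Hv0 & Hdu & Hdv & Hdd).
    assert (Hsq0 : sq u0 v0) by (split; apply Rabs_le_between; lra).
    specialize (Hdelta (u0, v0) Hsq0 u v (conj Hu Hv) Hdu Hdv). lra. }
  destruct (Htail (d / 2) ltac:(pose proof (cond_pos d); lra)) as [n0 Hn0].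
  exists n0. intros n u v Hn Hu Hv E.
  specialize (Hn0 n u v Hn (conj Hu Hv)). specialize (Hlow u v (conj Hu Hv)).
  pose proof (Htri (F (u, v)) (cpoly t n (u, v))) as H5.
  rewrite E in *. rewrite Cmod_0 in H5. pose proof (cond_pos d). lra.
Qed.

(** * Kummer's function *)

Lemma poch_pos (a : R) (k : nat) : 0 < a -> 0 < poch a k.
Proof.
  intros Ha. induction k as [|k IH]; simpl; [lra|].
  apply Rmult_lt_0_compat; [easy|]. pose proof (pos_INR k). lra.
Qed.

Lemma poch_le (a c : R) (k : nat) : 0 < a -> a <= c -> poch a k <= poch c k.
Proof.
  intros Ha Hc. induction k as [|k IH]; simpl; [lra|].
  pose proof (pos_INR k). pose proof (poch_pos a k Ha).
  apply Rmult_le_compat; lra.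
Qed.

Lemma pow_le_poch (c : R) (k : nat) : 0 < c -> c ^ k <= poch c k.
Proof.
  intros Hc. induction k as [|k IH]; simpl; [lra|].
  pose proof (pos_INR k). rewrite Rmult_comm.
  apply Rmult_le_compat; try lra. apply pow_le. lra.
Qed.

Lemma poch_le_pow (c d : R) (k : nat) :
  0 < c -> INR k <= d * c -> poch c k <= c ^ k * (1 + d) ^ k.
Proof.
  intros Hc Hk. rewrite <- Rpow_mult_distr. induction k as [|k IH]; simpl; [lra|].
  rewrite S_INR in Hk. pose proof (pos_INR k). pose proof (poch_pos c k Hc).
  rewrite Rmult_comm. apply Rmult_le_compat; lra.
Qed.

(** In [a (a + 1) ... (a + k)] each factor [a + j] with [j >= 1] is at least [j], so the product is
    at least [a * k!]. *)
Lemma poch_div_fact_ge (a : R) (k : nat) :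
  0 < a -> a / INR (S k) <= poch a (S k) / INR (fact (S k)).
Proof.
  intros Ha.
  assert (Hf : forall j, 0 < INR (fact j)) by (intros; apply lt_0_INR, lt_O_fact).
  assert (Hs : forall j, 0 < INR (S j)) by (intros; apply lt_0_INR; lia).
  enough (a * INR (fact k) <= poch a (S k)).
  { change (fact (S k)) with (S k * fact k)%nat. rewrite mult_INR.
    apply Rmult_le_reg_r with (INR (S k) * INR (fact k)); [now apply Rmult_lt_0_compat|].
    specialize (Hf k). specialize (Hs k).
    replace (a / INR (S k) * (INR (S k) * INR (fact k))) with (a * INR (fact k))
      by (field; lra).
    replace (poch a (S k) / (INR (S k) * INR (fact k)) * (INR (S k) * INR (fact k)))
      with (poch a (S k)) by (field; lra).
    easy. }
  induction k as [|k IH]; [simpl; lra|].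
  change (fact (S k)) with (S k * fact k)%nat. rewrite mult_INR.
  change (poch a (S (S k))) with (poch a (S k) * (a + INR (S k))).
  specialize (Hf k). specialize (Hs k). pose proof (poch_pos a (S k) Ha). nra.
Qed.

(** * Bounds for the rescaled Kummer series *)

Definition kummer_coef (a c : R) (k : nat) : R :=
  poch a k / (poch c k * INR (fact k)) * c ^ k.

Lemma F11_term_scaled (a c : R) (w : C) (k : nat) :
  F11_term a c (c * w) k = Cmult (RtoC (kummer_coef a c k)) (Cpow w k).
Proof.
  unfold F11_term, kummer_coef. rewrite Cpow_mult_l, RtoC_mult, RtoC_pow. ring.
Qed.

Lemma kummer_coef_pos (a c : R) (k : nat) : 0 < a -> 0 < c -> 0 < kummer_coef a c k.
Proof.
  intros Ha Hc. unfold kummer_coef.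
  pose proof (poch_pos a k Ha). pose proof (poch_pos c k Hc).
  assert (0 < INR (fact k)) by apply lt_0_INR, lt_O_fact.
  apply Rmult_lt_0_compat; [|now apply pow_lt].
  apply Rdiv_lt_0_compat; [easy|now apply Rmult_lt_0_compat].
Qed.

(** From [c ^ k <= poch c k]. The majorants are the Taylor coefficients of [(1 - w)^(-a)],
    independent of [c]. *)
Lemma kummer_coef_le_binomial (a c : R) (k : nat) :
  0 < a -> 0 < c -> kummer_coef a c k <= poch a k / INR (fact k).
Proof.
  intros Ha Hc. unfold kummer_coef.
  pose proof (poch_pos a k Ha). pose proof (poch_pos c k Hc).
  assert (0 < INR (fact k)) by apply lt_0_INR, lt_O_fact.
  assert (0 < poch a k / INR (fact k)) by now apply Rdiv_lt_0_compat.
  replace (poch a k / (poch c k * INR (fact k)) * c ^ k)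
    with (poch a k / INR (fact k) * (c ^ k / poch c k)) by (field; lra).
  rewrite <- (Rmult_1_r (poch a k / INR (fact k))) at 2.
  apply Rmult_le_compat_l; [lra|].
  apply Rmult_le_reg_r with (poch c k); [easy|].
  unfold Rdiv. rewrite Rmult_assoc, Rinv_l by lra.
  pose proof (pow_le_poch c k Hc). lra.
Qed.

(** From [poch a k <= poch c k]. The majorants are the Taylor coefficients of [exp (c w)], valid for
    all [w] but growing with [c]. *)
Lemma kummer_coef_le_exp (a c : R) (k : nat) :
  0 < a -> a <= c -> kummer_coef a c k <= c ^ k / INR (fact k).
Proof.
  intros Ha Hc. unfold kummer_coef.
  pose proof (poch_pos a k Ha). pose proof (poch_pos c k ltac:(lra)).
  pose proof (poch_le a c k Ha Hc).
  assert (0 < INR (fact k)) by apply lt_0_INR, lt_O_fact.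
  replace (poch a k / (poch c k * INR (fact k)) * c ^ k)
    with (c ^ k / INR (fact k) * (poch a k / poch c k)) by (field; lra).
  rewrite <- (Rmult_1_r (c ^ k / INR (fact k))) at 2.
  apply Rmult_le_compat_l.
  { left. apply Rdiv_lt_0_compat; [apply pow_lt; lra|easy]. }
  apply Rmult_le_reg_r with (poch c k); [easy|].
  unfold Rdiv. rewrite Rmult_assoc, Rinv_l by lra. lra.
Qed.

Lemma is_series_exp (c X : R) :
  is_series (fun k => c ^ k / INR (fact k) * X ^ k) (exp (c * X)).
Proof.
  eapply is_series_ext; [|apply (is_exp_Reals (c * X))].
  intros k. rewrite pow_n_pow, Rpow_mult_distr.
  change (c ^ k * X ^ k * / INR (fact k) = c ^ k / INR (fact k) * X ^ k).
  unfold Rdiv. ring.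
Qed.

Lemma ex_series_binomial (a q : R) :
  0 < a -> 0 < q < 1 -> ex_series (fun k => poch a k / INR (fact k) * q ^ k).
Proof.
  intros Ha Hq. set (u := fun k => poch a k / INR (fact k) * q ^ k).
  assert (Hu : forall k, 0 < u k).
  { intros k. apply Rmult_lt_0_compat; [|now apply pow_lt].
    apply Rdiv_lt_0_compat; [now apply poch_pos|apply lt_0_INR, lt_O_fact]. }
  apply (ex_series_ext (fun k => Rabs (u k))).
  { intros k. apply Rabs_right. left. apply Hu. }
  apply (ex_series_DAlembert u q ltac:(lra)).
  { intros k. specialize (Hu k). lra. }
  (* The ratio of consecutive terms is [q * (a + k) / (k + 1)]. *)
  apply (is_lim_seq_ext (fun k => q + q * (a - 1) * / INR (S k))).
  { intros k. rewrite Rabs_right by (left; now apply Rdiv_lt_0_compat).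
    unfold u. change (fact (S k)) with (S k * fact k)%nat. rewrite mult_INR.
    assert (INR (fact k) <> 0) by apply INR_fact_neq_0.
    pose proof (poch_pos a k Ha). pose proof (pow_lt q k ltac:(lra)).
    pose proof (pos_INR k). rewrite S_INR. simpl. field. repeat split; lra. }
  replace (Finite q) with (Rbar_plus q (Rbar_mult (q * (a - 1)) 0))
    by (simpl; f_equal; ring).
  apply is_lim_seq_plus'; [apply is_lim_seq_const|].
  apply (is_lim_seq_scal_l (fun k => / INR (S k)) (q * (a - 1)) 0).
  apply (is_lim_seq_incr_1 (fun k => / INR k)).
  apply is_lim_seq_inv with (l := p_infty); [apply is_lim_seq_INR|easy].
Qed.

Lemma sum_f_R0_ge_term (u : nat -> R) (k n : nat) :
  (forall i, 0 <= u i) -> (k <= n)%nat -> u k <= sum_f_R0 u n.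
Proof.
  intros Hu. induction n as [|n IH]; intros Hk.
  - replace k with O by lia. simpl. lra.
  - rewrite tech5. pose proof (Hu (S n)).
    destruct (Nat.eq_dec k (S n)) as [->|]; [|specialize (IH ltac:(lia)); lra].
    pose proof (cond_pos_sum u n Hu). lra.
Qed.

Lemma partial_sum_le_dominating_Series (u v : nat -> R) (n : nat) :
  (forall k, u k <= v k) -> (forall k, 0 <= v k) -> ex_series v -> sum_f_R0 u n <= Series v.
Proof.
  intros Huv Hv Hex. eapply Rle_trans; [apply sum_Rle; intros; apply Huv|].
  now apply partial_sum_le_Series.
Qed.

(** Only the term of index [S K] is kept: as [S K <= s / 2 * c], its [poch c (S K)] exceeds
    [c ^ S K] by at most the factor [(1 + s / 2) ^ S K]. *)
Lemma kummer_sum_ge (a c s : R) (K n : nat) :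
  0 < a -> 0 < c -> 0 < s -> INR (S K) <= s / 2 * c -> (S K <= n)%nat ->
  a / INR (S K) * ((1 + s) / (1 + s / 2)) ^ S K
    <= sum_f_R0 (fun k => kummer_coef a c k * (1 + s) ^ k) n.
Proof.
  intros Ha Hc Hs HK Hn.
  eapply Rle_trans; [|apply (sum_f_R0_ge_term _ (S K)); [|exact Hn]].
  2:{ intros i. apply Rmult_le_pos; [left; now apply kummer_coef_pos|apply pow_le; lra]. }
  pose proof (poch_pos c (S K) Hc) as Hpc.
  assert (Hf : 0 < INR (fact (S K))) by apply lt_0_INR, lt_O_fact.
  assert (Hcs := poch_le_pow c (s / 2) (S K) Hc HK).
  assert (H1 : 0 < (1 + s / 2) ^ S K) by (apply pow_lt; lra).
  unfold kummer_coef.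
  replace (poch a (S K) / (poch c (S K) * INR (fact (S K))) * c ^ S K * (1 + s) ^ S K)
    with (poch a (S K) / INR (fact (S K)) * (c ^ S K * (1 + s) ^ S K / poch c (S K)))
    by (field; lra).
  apply Rmult_le_compat.
  - left. apply Rdiv_lt_0_compat; [easy|]. apply lt_0_INR. lia.
  - apply pow_le. left. apply Rdiv_lt_0_compat; lra.
  - now apply poch_div_fact_ge.
  - unfold Rdiv at 1. rewrite Rpow_mult_distr, pow_inv.
    assert (H2 : 0 < (1 + s) ^ S K) by (apply pow_lt; lra).
    set (X := (1 + s) ^ S K) in *. set (Y := (1 + s / 2) ^ S K) in *.
    set (P := poch c (S K)) in *. set (Q := c ^ S K) in *.
    apply Rmult_le_reg_r with (P * Y); [now apply Rmult_lt_0_compat|].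
    replace (X * / Y * (P * Y)) with (X * P) by (field; lra).
    replace (Q * X / P * (P * Y)) with (X * (Q * Y)) by (field; lra).
    apply Rmult_le_compat_l; lra.
Qed.

Lemma kummer_sum_le_exp (a c X : R) (n : nat) :
  0 < a -> a <= c -> 0 <= X ->
  sum_f_R0 (fun k => kummer_coef a c k * X ^ k) n <= exp (c * X).
Proof.
  intros Ha Hc HX. rewrite <- (is_series_unique _ _ (is_series_exp c X)).
  apply partial_sum_le_dominating_Series; [| |eexists; apply is_series_exp].
  - intros k. apply Rmult_le_compat_r; [now apply pow_le|]. now apply kummer_coef_le_exp.
  - intros k. apply Rmult_le_pos; [|now apply pow_le].
    apply Rdiv_le_0_compat; [apply pow_le; lra|]. apply lt_0_INR, lt_O_fact.
Qed.

Lemma kummer_ex_series (a c X : R) :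
  0 < a -> a <= c -> 0 <= X -> ex_series (fun k => kummer_coef a c k * X ^ k).
Proof.
  intros Ha Hc HX.
  apply (ex_series_le (K := R_AbsRing) (V := R_CompleteNormedModule) _
    (fun k => c ^ k / INR (fact k) * X ^ k)); [|eexists; apply is_series_exp].
  intros k. change (Rabs (kummer_coef a c k * X ^ k) <= c ^ k / INR (fact k) * X ^ k).
  rewrite Rabs_right.
  - apply Rmult_le_compat_r; [now apply pow_le|]. now apply kummer_coef_le_exp.
  - apply Rle_ge, Rmult_le_pos; [|now apply pow_le]. left. apply kummer_coef_pos; lra.
Qed.

Lemma kummer_zero_near_one (a s : R) :
  0 < a -> 0 < s <= / 3 ->
  exists c0, 0 < c0 /\ forall c, c0 < c -> exists x y,
    Rabs (x - 1) <= 5 * s /\ Rabs (y - 0) <= 5 * s /\ F11_value a c (c * (x, y)) (RtoC 0).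
Proof.
  intros Ha Hs.
  set (q := 1 - s / 2).
  set (A := Series (fun k => poch a k / INR (fact k) * q ^ k)).
  set (g := (1 + s) / (1 + s / 2)).
  assert (Hg : 1 < g).
  { unfold g. apply Rmult_lt_reg_r with (1 + s / 2); [lra|]. unfold Rdiv.
    rewrite Rmult_assoc, Rinv_l; lra. }
  assert (Hlg : 0 < ln g) by (rewrite <- ln_1; apply ln_increasing; lra).
  (* With [k = S K], the growth [k * ln g = 4 * k * mu] is spent as follows: [2 * k * mu] on the
     large disc, [k * mu] on [ln k], and the last [k * mu] beats the constants once [k > K0]. *)
  set (mu := ln g / 4).
  assert (Hmu : 0 < mu) by (unfold mu; lra).
  (* [N] is fixed before [c]; the factor 32 makes the large-disc term [4 * c * (/ 2) ^ N] at most
     [k * ln g / 2], given [s * c <= 4 * k]. *)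
  destruct (pow_lt_1_zero (/ 2) ltac:(rewrite Rabs_right; lra) (ln g * s / 32)) as [N HN].
  { apply Rdiv_lt_0_compat; [apply Rmult_lt_0_compat; lra|lra]. }
  specialize (HN N (le_n N)). apply Rabs_def2, proj1 in HN.
  set (D := ln A + 2 * ln A * sum_f_R0 (fun k => (2 * s / (s / 2)) ^ k) N).
  set (K0 := (D - ln a - ln mu) / mu).
  (* Beyond this threshold [c >= a], and the floor of [s * c / 2] is positive and exceeds [K0]. *)
  exists (Rmax (Rmax 1 a) (2 * (Rabs K0 + 2) / s)).
  assert (0 < Rmax (Rmax 1 a) (2 * (Rabs K0 + 2) / s)).
  { pose proof (Rmax_l (Rmax 1 a) (2 * (Rabs K0 + 2) / s)). pose proof (Rmax_l 1 a). lra. }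
  split; [easy|]. intros c Hc.
  assert (Hca : a <= c).
  { pose proof (Rmax_l (Rmax 1 a) (2 * (Rabs K0 + 2) / s)). pose proof (Rmax_r 1 a). lra. }
  assert (Hcs : Rabs K0 + 2 < s / 2 * c).
  { pose proof (Rmax_r (Rmax 1 a) (2 * (Rabs K0 + 2) / s)) as H'.
    apply Rmult_lt_reg_r with (2 / s); [apply Rdiv_lt_0_compat; lra|].
    replace (s / 2 * c * (2 / s)) with c by (field; lra).
    replace ((Rabs K0 + 2) * (2 / s)) with (2 * (Rabs K0 + 2) / s) by (field; lra). lra. }
  assert (Hc0 : 0 < c) by lra. clear H Hc.
  destruct (nfloor_ex (s / 2 * c)) as [K' [HK1 HK2]].
  { pose proof (Rabs_pos K0). lra. }
  pose proof (Rabs_pos K0) as HK0pos.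
  destruct K' as [|K]; [simpl in HK2; lra|].
  apply NNPP. intros Hno.
  set (t := kummer_coef a c).
  assert (Ht : forall k, 0 <= t k) by (intros; left; now apply kummer_coef_pos).
  assert (Hex : ex_series (fun k => t k * 5 ^ k)) by (apply kummer_ex_series; lra).
  assert (HF : exists F : C -> C, forall w, Cmod w <= 5 -> is_cseries t w (F w)).
  { apply (functional_choice (fun w v => Cmod w <= 5 -> is_cseries t w v)).
    intros w. destruct (Rle_dec (Cmod w) 5) as [Hw|Hw]; [|now exists (RtoC 0)].
    destruct (ex_cseries t w 5 Ht Hw Hex) as [v Hv]. now exists v. }
  destruct HF as [F HF].
  assert (Hsq : forall u v, Rabs (u - 1) <= 5 * s -> Rabs (v - 0) <= 5 * s -> Cmod (u, v) <= 5).
  { intros u v Hu Hv.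
    replace (u, v) with (RtoC (u - 1) + Ci * RtoC (v - 0) + 1)%C
      by (unfold RtoC, Ci, Cplus, Cmult; simpl; f_equal; ring).
    eapply Rle_trans; [apply Cmod_triangle|]. rewrite Cmod_1.
    eapply Rle_trans; [apply Rplus_le_compat_r, Cmod_triangle|].
    rewrite Cmod_mult, Cmod_Ci, !Cmod_R. lra. }
  destruct (cpoly_zero_free_on_square t F 1 0 (5 * s) 5 Ht Hex Hsq HF) as [n0 Hn0].
  { intros u v Hu Hv E. apply Hno. exists u, v. repeat split; try easy.
    specialize (HF (u, v) (Hsq u v Hu Hv)). rewrite E in HF.
    unfold F11_value. eapply is_series_ext; [|exact HF].
    intros k. symmetry. apply F11_term_scaled. }
  (* Late enough to be zero-free on the square and to contain the large term of index [S K]. *)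
  set (n := Nat.max n0 (S K)).
  assert (Hlow : a / INR (S K) * g ^ S K <= sum_f_R0 (fun k => t k * (1 + s) ^ k) n).
  { apply kummer_sum_ge; try lra. lia. }
  assert (Hx0 : forall r z, Cmod z <= r -> Cmod (RtoC (1 - s) + z) <= 1 - s + r).
  { intros r z Hz. eapply Rle_trans; [apply Cmod_triangle|].
    rewrite Cmod_R, Rabs_right; lra. }
  (* Around [1 - s], radius [s / 2] stays in the disc of radius [q < 1]; radius [4 * s] stays in the
     square of half side [5 * s] about 1 and, as [s <= / 3], in the disc of radius 2. Distance
     [2 * s] reaches [1 + s], with ratio 1/2 to the large radius. *)
  assert (Hup := cpoly_ln_two_disc_bound t n (1 - s) (s / 2) (4 * s) (2 * s) A (exp (c * 2)) N).
  rewrite ln_exp, <- RtoC_plus in Hup.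
  replace (1 - s + 2 * s) with (1 + s) in Hup by ring.
  rewrite (cpoly_RtoC t n (1 + s)), Cmod_R in Hup.
  assert (HS : 0 < a / INR (S K) * g ^ S K).
  { apply Rmult_lt_0_compat; [|apply pow_lt; lra].
    apply Rdiv_lt_0_compat; [easy|apply lt_0_INR; lia]. }
  rewrite Rabs_right in Hup by lra.
  assert (Hq : 0 < q < 1) by (unfold q; lra).
  fold D in Hup.
  replace (2 * s / (4 * s)) with (/ 2) in Hup by (field; lra).
  assert (Hfin : ln a - ln (INR (S K)) + INR (S K) * ln g
    <= D + 2 * (c * 2) * ((/ 2) ^ S N / (1 - / 2))).
  { eapply Rle_trans; [|apply Hup].
    - eapply Rle_trans; [|apply ln_le; [exact HS|exact Hlow]].
      assert (0 < INR (S K)) by (apply lt_0_INR; lia).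
      rewrite ln_mult, ln_div, ln_pow; try lra.
      + apply Rdiv_lt_0_compat; lra.
      + apply pow_lt; lra.
    - apply Rgt_not_eq. now apply kummer_coef_pos.
    - lra.
    - lra.
    - intros z Hz. rewrite (surjective_pairing (RtoC (1 - s) + z)%C).
      assert (Hre := re_le_Cmod z).
      assert (Him : Rabs (Im z) <= Cmod z).
      { eapply Rle_trans; [apply Rmax_r|apply Rmax_Cmod]. }
      destruct z as [zx zy]; simpl in Hre, Him |- *.
      apply Rabs_le_between in Hre, Him.
      apply Hn0; [lia| |]; apply Rabs_le_between; lra.
    - intros z Hz. eapply Rle_trans; [apply (Cmod_cpoly_le t n _ q Ht)|].
      + eapply Rle_trans; [apply (Hx0 _ _ Hz)|]. unfold q. lra.
      + apply partial_sum_le_dominating_Series; [| |now apply ex_series_binomial].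
        * intros k. apply Rmult_le_compat_r; [apply pow_le; lra|].
          now apply kummer_coef_le_binomial.
        * intros k. apply Rmult_le_pos; [|apply pow_le; lra].
          apply Rdiv_le_0_compat; [left; now apply poch_pos|apply lt_0_INR, lt_O_fact].
    - intros z Hz. eapply Rle_trans; [apply (Cmod_cpoly_le t n _ 2 Ht)|].
      + eapply Rle_trans; [apply (Hx0 _ _ Hz)|]. lra.
      + apply kummer_sum_le_exp; lra.
    - rewrite cpoly_RtoC, Cmod_R.
      eapply Rle_trans; [|apply Rle_abs].
      eapply Rle_trans; [|apply (sum_f_R0_ge_term _ 0); [|lia]].
      + unfold t, kummer_coef. simpl. lra.
      + intros i. apply Rmult_le_pos; [apply Ht|apply pow_le; lra]. }
  assert (HKpos : 1 <= INR (S K)) by (rewrite S_INR; pose proof (pos_INR K); lra).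
  assert (Hlog : ln (INR (S K)) <= INR (S K) * mu - ln mu).
  { assert (Hl : ln (INR (S K) * mu) <= INR (S K) * mu).
    { rewrite <- (ln_exp (INR (S K) * mu)) at 2.
      assert (0 < INR (S K) * mu) by (apply Rmult_lt_0_compat; lra).
      apply ln_le; [easy|]. pose proof (exp_ineq1 (INR (S K) * mu)). lra. }
    rewrite ln_mult in Hl by lra. lra. }
  assert (Hpow : 2 * (c * 2) * ((/ 2) ^ S N / (1 - / 2)) <= INR (S K) * ln g / 2).
  { replace ((/ 2) ^ S N / (1 - / 2)) with ((/ 2) ^ N) by (simpl; field).
    assert (H1 : 4 * c * (/ 2) ^ N <= 4 * c * (ln g * s / 32)) by (apply Rmult_le_compat_l; lra).
    (* By the choice of the floor, [s * c / 2 < S K + 1 <= 2 * S K]. *)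
    assert (H2 : s * c * (ln g / 8) <= 4 * INR (S K) * (ln g / 8))
      by (apply Rmult_le_compat_r; lra).
    lra. }
  assert (HK0 : K0 * mu = D - ln a - ln mu) by (unfold K0; field; lra).
  assert (K0 < INR (S K)) by (pose proof (Rle_abs K0); lra).
  assert (K0 * mu < INR (S K) * mu) by (apply Rmult_lt_compat_r; lra).
  unfold mu in *. lra.
Qed.

Theorem theorem6p1 (a : R) (ha : 0 < a) :
  exists (zs : R -> C) (c0 : R),
    0 < c0 /\
    (forall c : R, c0 < c -> F11_value a c (zs c) (RtoC 0)) /\
    filterlim (fun c : R => Cdiv (zs c) (RtoC c)) (Rbar_locally p_infty)
      (locally (RtoC 1)).
Proof.
  (* The zeros found so far depend on the tolerance [s], whereas [zs] must be one function of [c].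
     The value [/ 3] only secures a zero for every [c > c0]. *)
  destruct (kummer_zero_near_one a (/ 3) ha ltac:(lra)) as (c0 & Hc0 & Hzero).
  (* A zero at almost minimal relative distance from [c] inherits every asymptotic bound. *)
  assert (Hbest : forall c, exists z, c0 < c -> F11_value a c z (RtoC 0) /\
    forall w, F11_value a c w (RtoC 0) -> Cmod (z / c - 1) <= Cmod (w / c - 1) + / c).
  { intros c. destruct (Rlt_dec c0 c) as [Hc|]; [|now exists (RtoC 0)].
    (* Negated distances turn the infimum into a supremum; the slack [/ c] avoids having to attain
       it and vanishes in the limit. *)
    set (S := fun r => exists w, F11_value a c w (RtoC 0) /\ r = - Cmod (w / c - 1)).
    destruct (completeness S) as [m [Hub Hlub]].
    - exists 0. intros r (w & _ & ->). pose proof (Cmod_ge_0 (w / c - 1)). lra.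
    - destruct (Hzero c Hc) as (x & y & _ & _ & Hw). eexists. eexists. split; [exact Hw|easy].
    - assert (Hinv : 0 < / c) by (apply Rinv_0_lt_compat; lra).
      destruct (classic (exists z, F11_value a c z (RtoC 0) /\ m - / c <= - Cmod (z / c - 1)))
        as [(z & Hz & Hm)|Hno].
      + exists z. intros _. split; [easy|]. intros w Hw.
        specialize (Hub _ (ex_intro _ w (conj Hw eq_refl))). lra.
      + exfalso. enough (m <= m - / c) by lra. apply Hlub. intros r (w & Hw & ->).
        apply Rnot_lt_le. intros Hlt. apply Hno. exists w. split; [easy|lra]. }
  apply functional_choice in Hbest. destruct Hbest as [zs Hzs].
  exists zs, c0. split; [easy|]. split; [intros c Hc; now apply Hzs|].
  apply filterlim_locally. intros eps. pose proof (cond_pos eps) as Heps.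
  (* The relative distance [10 * s] is then below [eps / 2], which leaves [eps / 2] for the slack
     [/ c]. *)
  set (s := Rmin (/ 3) (eps / 22)).
  assert (Hs : 0 < s <= / 3).
  { unfold s. split; [apply Rmin_pos; lra|apply Rmin_l]. }
  pose proof (Rmin_r (/ 3) (eps / 22)) as Hs'. fold s in Hs'.
  destruct (kummer_zero_near_one a s ha Hs) as (c1 & Hc1 & Hzero1).
  exists (Rmax (Rmax c0 c1) (2 / eps)). intros c Hc.
  pose proof (Rmax_l (Rmax c0 c1) (2 / eps)). pose proof (Rmax_r (Rmax c0 c1) (2 / eps)).
  pose proof (Rmax_l c0 c1). pose proof (Rmax_r c0 c1).
  destruct (Hzs c ltac:(lra)) as [_ Hmin].
  destruct (Hzero1 c ltac:(lra)) as (x & y & Hx & Hy & Hw).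
  specialize (Hmin _ Hw).
  assert (Hcnz : RtoC c <> RtoC 0) by (intros E; injection E; lra).
  assert (Hxy : Cmod (c * (x, y) / c - 1) <= 10 * s).
  { replace (c * (x, y) / c - 1)%C with ((x, y) - 1)%C by (field; easy).
    replace ((x, y) - 1)%C with (RtoC (x - 1) + Ci * RtoC (y - 0))%C
      by (unfold RtoC, Ci, Cminus, Copp, Cplus, Cmult; simpl; f_equal; ring).
    eapply Rle_trans; [apply Cmod_triangle|]. rewrite Cmod_mult, Cmod_Ci, !Cmod_R. lra. }
  assert (Hinv : / c < eps / 2).
  { replace (eps / 2) with (/ (2 / eps)) by (field; lra).
    apply Rinv_0_lt_contravar; [apply Rdiv_lt_0_compat|]; lra. }
  apply C_NormedModule_mixin_compat1.
  change (Cmod (zs c / c - 1) < eps). lra.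
Qed.
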